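(* Let $\mathsf{M}=(E,\mathscr{B})$ be a matroid of rank $k$ with ground set $E$ and family of bases $\mathscr{B}$. If $H$ is a stressed hyperplane of $\mathsf{M}$, then the family \[ \widetilde{\mathscr{B}} = \mathscr{B} \sqcup \{ S \subseteq H : |S| = k\} \] is the family of bases of a matroid $\widetilde{\mathsf{M}}=(E,\widetilde{\mathscr{B}})$.
   Context: A hyperplane of a matroid of rank $k$ is a flat of rank $k-1$. A hyperplane $H$ of a matroid $\mathsf{M}$ of rank $k$ is called stressed if every subset of $H$ of cardinality $k$ is a circuit of $\mathsf{M}$. *)

(* Defs.v *)
From HB Require Import structures.
From mathcomp Require Import all_boot.

Set Implicit Arguments.
Unset Strict Implicit.
Unset Printing Implicit Defensive.

(* The ground set is the whole finite type [E]. *)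
Record matroid (E : finType) := Matroid {
  bases : {set {set E}};
  bases_neq0 : bases != set0;
  bases_exchange : forall (A B : {set E}) (a : E),
    A \in bases -> B \in bases -> a \in A :\: B ->
    exists2 b, b \in B :\: A & b |: (A :\ a) \in bases
}.

Section MatroidTheory.
Variables (E : finType) (M : matroid E).
Implicit Types (A C F H I : {set E}).

Definition indep I : bool := [exists B in bases M, I \subset B].

Definition rank A : nat := \max_(I in powerset A | indep I) #|I|.

Definition matroid_rank : nat := rank [set: E].

Definition circuit C : bool := minset (fun A => ~~ indep A) C.

Definition flat F : bool := [forall x, (x \notin F) ==> (rank F < rank (x |: F))].

(* "Rank k - 1" is written with a successor, so that a matroid of rank 0 has no
   hyperplane. *)
Definition hyperplane H : bool := flat H && ((rank H).+1 == matroid_rank).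

Definition stressed H : bool :=
  [forall S : {set E}, (S \subset H) && (#|S| == matroid_rank) ==> circuit S].

Definition stressed_hyperplane H : bool := hyperplane H && stressed H.

End MatroidTheory.

(* Main.v *)
Require Import Defs.
From mathcomp Require Import all_boot.

(** The [k]-subsets of [H] are circuits, so their [k-1]-subsets are independent
    and span [H]; since [H] is a flat, adding any point outside [H] to such a
    [k-1]-subset gives a basis.  This settles the exchange property as soon as
    a point outside [H] is available.  In the remaining delicate case, [A] is a
    basis with [A :\ a] not inside [H] and [B] is a [k]-subset of [H]: for
    [x] in [A :\ a] outside [H] and [c] in [B], the set [x |: (B :\ c)] is a basis,
    and completing [A :\ a] from this basis can only use a point of [B]. *)

Section MatroidBases.
Set Implicit Arguments.
Unset Strict Implicit.
Variables (E : finType) (M : matroid E).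
Implicit Types (A B I S H : {set E}) (a b c x : E).

Lemma card_exchange A a b : a \in A -> b \notin A -> #|b |: (A :\ a)| = #|A|.
Proof.
by move=> aA bA; rewrite cardsU1 !inE (negPf bA) andbF (cardsD1 a A) aA.
Qed.

(** Each exchange keeps the size of [A] and trades a point outside [B] for one inside it, so
    [A :\: B] shrinks until [A] is contained in [B]. *)
Lemma leq_card_bases A B : A \in bases M -> B \in bases M -> #|A| <= #|B|.
Proof.
have [n] := ubnP #|A :\: B|; elim: n A => // n IHn A ltAB Ab Bb.
have [|[a aAB]] := set_0Vmem (A :\: B).
  by move/eqP; rewrite setD_eq0 => /subset_leq_card.
have [b bBA A'b] := bases_exchange Ab Bb aAB.
move: (aAB) (bBA); rewrite !inE => /andP[aB aA] /andP[bA bB].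
rewrite -(card_exchange aA bA); apply: IHn => //.
rewrite -ltnS; apply: leq_trans ltAB; rewrite ltnS.
apply: proper_card; apply/properP; split.
  apply/subsetP=> y; rewrite !inE => /andP[yB].
  by case/orP=> [/eqP yb|/andP[_ ->]]; [rewrite yb bB in yB | rewrite yB].
exists a => //; rewrite !inE eqxx orbF aB /=.
by apply: contraNneq bA => <-.
Qed.

Lemma eq_card_bases A B : A \in bases M -> B \in bases M -> #|A| = #|B|.
Proof.
by move=> Ab Bb; apply/eqP; rewrite eqn_leq !leq_card_bases.
Qed.

Lemma leq_card_rank I A : I \subset A -> indep M I -> #|I| <= rank M A.
Proof.
move=> IA Ii; rewrite /rank.
by apply: (bigmax_sup I); rewrite // powersetE IA.
Qed.

Lemma indep_subset I A : I \subset A -> indep M A -> indep M I.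
Proof.
move=> IA /exists_inP[B Bb AB]; apply/exists_inP; exists B => //.
exact: subset_trans IA AB.
Qed.

Lemma base_indep B : B \in bases M -> indep M B.
Proof. by move=> Bb; apply/exists_inP; exists B. Qed.

Lemma rank_attained A : exists2 I : {set E}, (I \subset A) && indep M I & #|I| = rank M A.
Proof.
(* The empty set makes the family under the maximum nonempty, so the maximum is attained and is not
   a mere default 0. *)
have i0 : indep M set0.
  have /set0Pn[B Bb] := bases_neq0 M.
  exact: indep_subset (sub0set B) (base_indep Bb).
have P0 : 0 < #|[pred I : {set E} | (I \in powerset A) && indep M I]|.
  by apply/card_gt0P; exists set0; rewrite inE powersetE sub0set.
have [I] := eq_bigmax_cond (fun I : {set E} => #|I|) P0.
by rewrite inE powersetE => PI eqI; exists I.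
Qed.

Lemma card_base B : B \in bases M -> #|B| = matroid_rank M.
Proof.
move=> Bb; apply/eqP; rewrite eqn_leq leq_card_rank ?subsetT ?base_indep //=.
have [I /andP[_ /exists_inP[C Cb IC]]] := rank_attained [set: E].
rewrite -/(matroid_rank M) => <-.
by rewrite (eq_card_bases Bb Cb) subset_leq_card.
Qed.

Lemma indep_base I : indep M I -> matroid_rank M <= #|I| -> I \in bases M.
Proof.
case/exists_inP=> B Bb IB leI; suff -> : I = B by [].
by apply/eqP; rewrite eqEcard IB (card_base Bb).
Qed.

(** Start from any basis containing [I] and exchange its points outside [I :|: B] for points of [B]:
    their number drops each time, and no point of [I] is ever removed. *)
Lemma indep_completion I B : indep M I -> B \in bases M ->
  exists2 C : {set E}, C \in bases M & (I \subset C) && (C \subset I :|: B).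
Proof.
case/exists_inP=> A Ab IA Bb; move: Ab IA.
have [n] := ubnP #|A :\: (I :|: B)|; elim: n A => // n IHn A ltA Ab IA.
have [|[x]] := set_0Vmem (A :\: (I :|: B)).
  by move/eqP; rewrite setD_eq0 => AIB; exists A; rewrite ?IA.
rewrite !inE negb_or => /andP[/andP[xI xB] xA].
have [|b] := bases_exchange (a := x) Ab Bb; first by rewrite inE xB.
rewrite inE => /andP[bA bB] A'b; apply: IHn A'b _.
- rewrite -ltnS; apply: leq_trans ltA; rewrite ltnS.
  apply: proper_card; apply/properP; split.
    apply/subsetP=> y; rewrite !inE => /andP[yIB].
    case/orP=> [/eqP yb|/andP[_ ->]]; last by rewrite yIB.
    by rewrite yb bB orbT in yIB.
  exists x; rewrite !inE ?negb_or ?xI ?xB //= eqxx orbF.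
  by apply: contraNneq bA => <-.
- apply/subsetP=> y yI; rewrite !inE (subsetP IA) // andbT orbC.
  by rewrite (memPn xI).
Qed.

Lemma indep_augment I B : indep M I -> #|I|.+1 = matroid_rank M ->
  B \in bases M -> exists2 e, e \in B :\: I & e |: I \in bases M.
Proof.
move=> Ii cI Bb; have [C Cb /andP[IC CIB]] := indep_completion Ii Bb.
have [e eC eI] : exists2 e, e \in C & e \notin I.
  by apply/subsetPn; apply/negP => /subset_leq_card; rewrite card_base // -cI ltnn.
have eIC : e |: I \subset C by rewrite subUset sub1set eC.
exists e; first by have := subsetP CIB _ eC; rewrite !inE (negPf eI).
apply: indep_base; first exact: indep_subset eIC (base_indep Cb).
by rewrite cardsU1 eI add1n cI.
Qed.

Lemma base_not_sub_hyperplane H B :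
  hyperplane M H -> B \in bases M -> ~~ (B \subset H).
Proof.
case/andP=> _ /eqP rH Bb; apply/negP => /leq_card_rank/(_ (base_indep Bb)).
by rewrite card_base // -rH ltnn.
Qed.

(** By flatness, [x |: H] has full rank and so contains a basis [J]. Augmenting [I] from [J] must
    use [x], since a point of [H] would give a basis inside [H]. *)
Lemma hyperplane_extend H I x : hyperplane M H -> x \notin H -> I \subset H ->
  indep M I -> #|I|.+1 = matroid_rank M -> x |: I \in bases M.
Proof.
move=> hH xH IH Ii cI; have /andP[/forallP/(_ x) flH /eqP rH] := hH.
rewrite xH /= in flH.
have [J /andP[JH Ji] cJ] := rank_attained (x |: H).
have Jb : J \in bases M by apply: indep_base; rewrite // cJ -rH.
have [e] := indep_augment Ii cI Jb; rewrite inE => /andP[_ eJ] eIb.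
move: (subsetP JH _ eJ); rewrite !inE => /orP[/eqP <- //|eH].
by move: (base_not_sub_hyperplane hH eIb); rewrite subUset sub1set eH IH.
Qed.

Lemma stressed_indepD1 H S a : stressed M H -> S \subset H ->
  #|S| = matroid_rank M -> a \in S -> indep M (S :\ a).
Proof.
move=> /forallP/(_ S) sH SH cS aS; rewrite SH cS eqxx /= in sH.
(* By minimality of the circuit [S], a dependent [S :\ a] would equal [S], yet it misses [a]. *)
have [//|dep] := boolP (indep M (S :\ a)); have := minsetinf sH dep (subsetDl _ _).
by move/setP/(_ a); rewrite !inE eqxx aS.
Qed.

End MatroidBases.

Section Relaxation.
Set Implicit Arguments.
Unset Strict Implicit.
Variables (E : finType) (M : matroid E) (H : {set E}).
Hypothesis hH : stressed_hyperplane M H.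
Implicit Types A B S : {set E}.

Let k := matroid_rank M.
Let newB := [set S : {set E} | (S \subset H) && (#|S| == k)].

Lemma relaxation_disjoint : [disjoint bases M & newB].
Proof.
have /andP[hyp _] := hH.
apply/pred0P=> B /=; rewrite inE; apply/negP => /and3P[Bb BH _].
by have := base_not_sub_hyperplane hyp Bb; rewrite BH.
Qed.

Lemma relaxation_neq0 : bases M :|: newB != set0.
Proof.
have /set0Pn[B Bb] := bases_neq0 M.
by apply/set0Pn; exists B; rewrite inE Bb.
Qed.

Lemma relaxation_card B : B \in bases M :|: newB -> #|B| = k.
Proof.
by rewrite !inE => /orP[/card_base|/andP[_ /eqP]].
Qed.

Lemma relaxation_exchange A B a :
  A \in bases M :|: newB -> B \in bases M :|: newB -> a \in A :\: B ->
  exists2 b, b \in B :\: A & b |: (A :\ a) \in bases M :|: newB.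
Proof.
have /andP[hyp str] := hH.
move=> At Bt aAB; have cA := relaxation_card At; have cB := relaxation_card Bt.
move: (aAB); rewrite inE => /andP[aB aA].
have cAa : #|A :\ a|.+1 = k by rewrite -cA (cardsD1 a A) aA.
(* As [A] and [B] have the same size, [B \subset A] would force [B = A], against [a \notin B]. *)
have [b bB bA] : exists2 b, b \in B & b \notin A.
  apply/subsetPn; apply: contraNN aB => BA.
  have /eqP -> : B == A by rewrite eqEcard BA cA cB leqnn.
  exact: aA.
(* When everything stays inside [H], any such [b] works: the result is again a [k]-subset of [H]. *)
have inH : A :\ a \subset H -> B \subset H ->
    exists2 b, b \in B :\: A & b |: (A :\ a) \in bases M :|: newB.
  move=> AH BH; exists b; first by rewrite inE bA.
  rewrite inE [_ \in newB]inE subUset sub1set (subsetP BH) //= AH.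
  by rewrite card_exchange // cA eqxx orbT.
move: At; rewrite inE => /orP[Ab|]; last rewrite inE => /andP[AH _].
  move: Bt; rewrite inE => /orP[Bb|].
    have [c cBA cb] := bases_exchange Ab Bb aAB.
    by exists c; rewrite // inE cb.
  rewrite inE => /andP[BH _].
  have [|/subsetPn[x xA xH]] := boolP (A :\ a \subset H); first by move/inH; apply.
  have Db : x |: (B :\ b) \in bases M.
    apply: hyperplane_extend hyp xH _ _ _.
    - exact: subset_trans (subsetDl _ _) BH.
    - exact: stressed_indepD1 str BH cB bB.
    - by rewrite -/k -cB (cardsD1 b B) bB.
  have Ai := indep_subset (subsetDl A [set a]) (base_indep Ab).
  have [e] := indep_augment Ai cAa Db.
  rewrite inE => /andP[eA eD] eb; exists e; last by rewrite inE eb.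
  (* The only other candidate, [x], already lies in [A :\ a]. *)
  have eB : e \in B.
    move: eD; rewrite !inE => /orP[/eqP ex|/andP[] //].
    by rewrite ex xA in eA.
  (* Since [e] avoids [A :\ a], it could lie in [A] only as [a], which is not in [B]. *)
  move: eA; rewrite !inE eB andbT; apply: contraNN => ->.
  by rewrite andbT (memPn aB).
(* Here [A] is a [k]-subset of [H]. If [B] is one too, [inH] applies; if [B] is a basis, it has a
   point [c] outside [H], which extends the independent set [A :\ a]. *)
have AaH : A :\ a \subset H := subset_trans (subsetDl _ _) AH.
move: Bt; rewrite inE => /orP[Bb|]; last by rewrite inE => /andP[/(inH AaH)].
have /subsetPn[c cB' cH] := base_not_sub_hyperplane hyp Bb.
exists c; first by rewrite inE cB' (contraNN (subsetP AH c)).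
rewrite inE (hyperplane_extend hyp cH AaH) //.
exact: stressed_indepD1 str AH cA aA.
Qed.

End Relaxation.

(* The first conjunct is the disjointness asserted by the symbol "\sqcup". *)
Theorem theorem3p4 (E : finType) (M : matroid E) (k : nat)
    (hk : matroid_rank M = k) (H : {set E}) (hH : stressed_hyperplane M H) :
  [disjoint bases M & [set S : {set E} | (S \subset H) && (#|S| == k)]] /\
  exists M' : matroid E,
    bases M' = bases M :|: [set S : {set E} | (S \subset H) && (#|S| == k)].
Proof.
rewrite -hk; split; first exact: relaxation_disjoint.
by exists (Matroid (relaxation_neq0 M H) (relaxation_exchange hH)).
Qed.
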